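(* Let $E$ be a Banach space and $\mathcal D$ a convexity condition. There exists a pair $\bigl(\mathrm{FBL}^{\mathcal D}[E],\phi_E^{\mathcal D}\bigr)$, where $\mathrm{FBL}^{\mathcal D}[E]$ is a $\mathcal D$-convex Banach lattice and $\phi_E^{\mathcal D}\colon E\to\mathrm{FBL}^{\mathcal D}[E]$ is a linear isometry, with the following universal property: for every $\mathcal D$-convex Banach lattice $X$ and every operator $T\colon E\to X$, there exists a unique lattice homomorphism $\widehat T\colon\mathrm{FBL}^{\mathcal D}[E]\to X$ such that $\widehat T\circ\phi_E^{\mathcal D}=T$. Moreover, $\|\widehat T\|=\|T\|$.
   Context: All vector spaces, Banach spaces and Banach lattices are real; ''operator'' means bounded linear operator, ''lattice homomorphism'' means linear lattice homomorphism, and linear isometries are not assumed surjective. For $m\in\mathbb N$, $\mathcal H_m$ denotes the vector lattice of continuous, positively homogeneous functions $\mathbb R^m\to\mathbb R$. For a Banach lattice $X$, $h\in\mathcal H_m$ and $x_1,\dots,x_m\in X$, the element $h(x_1,\dots,x_m)\in X$ is defined by the positively homogeneous continuous function calculus: it is $\Phi(h)$, where $\Phi\colon\mathcal H_m\to X$ is the unique lattice homomorphism sending the $k$-th coordinate projection to $x_k$ for each $k$. A function $h\in\mathcal H_m$ is monotone on $\mathbb R^m_+$ if $h(t_1,\dots,t_m)\le h(s_1,\dots,s_m)$ whenever $0\le t_k\le s_k$ for all $k$; $\mathcal H_m^{>0}$ is the set of $h\in\mathcal H_m$ that are monotone on $\mathbb R^m_+$. A convexity condition is a triple $\mathcal D=(\mathcal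 G,M,\vartheta)$, where $\mathcal G$ is a nonempty subset of $\bigcup_{m=1}^\infty\mathcal H_m^{>0}$ and $M\colon\mathcal G\to[1,\infty)$ and $\vartheta\colon\mathcal G\to\{0,1\}$ are arbitrary functions. A Banach lattice $X$ is $\mathcal D$-convex if, for every $m\in\mathbb N$ and $g\in\mathcal G\cap\mathcal H_m^{>0}$, the inequality $$\|g(x_1,\dots,x_m)\|\le M(g)\cdot g(\|x_1\|,\dots,\|x_m\|)$$ holds for all pairwise disjoint $x_1,\dots,x_m\in X_+$ if $\vartheta(g)=0$, and for all $x_1,\dots,x_m\in X_+$ if $\vartheta(g)=1$. *)

(* Defs.v *)
From HB Require Import structures.
From mathcomp Require Import all_boot all_order all_algebra.
From mathcomp Require Import all_classical all_reals all_analysis.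

Set Implicit Arguments.
Unset Strict Implicit.
Unset Printing Implicit Defensive.

Import Order.TTheory GRing.Theory Num.Theory.
Import numFieldNormedType.Exports.

Local Open Scope classical_set_scope.
Local Open Scope ring_scope.

(* The order is axiomatized here, rather than inherited from [porderType] and
   [latticeType], because Hierarchy-Builder rejects new structures combining an
   order with a normed module: [numDomainType] already combines the two, and
   MathComp declares no intermediate structure between them. *)
Reserved Notation "x <=v y" (at level 70, no associativity).

HB.mixin Record Lmodule_isVectorLattice (R : numDomainType) V
    of GRing.Lmodule R V := {
  vle : rel V ;
  vjoin : V -> V -> V ;
  vmeet : V -> V -> V ;
  vle_refl : reflexive vle ;
  vle_anti : antisymmetric vle ;
  vle_trans : transitive vle ;
  vle_join : forall x y z : V, vle (vjoin x y) z = vle x z && vle y z ;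
  vle_meet : forall x y z : V, vle z (vmeet x y) = vle z x && vle z y ;
  vle_addr : forall z x y : V, vle x y -> vle (x + z) (y + z) ;
  vle_scale : forall (a : R) (x : V), 0 <= a -> vle 0 x -> vle 0 (a *: x)
}.

#[short(type="vectorLatticeType")]
HB.structure Definition VectorLattice (R : numDomainType) :=
  {V of GRing.Lmodule R V & Lmodule_isVectorLattice R V}.

Notation "x <=v y" := (vle x y) : ring_scope.

(* The modulus of a vector lattice; [`|x|] denotes the norm. *)
Definition vabs (R : numDomainType) (V : vectorLatticeType R) (x : V) : V :=
  vjoin x (- x).

Definition disjoint_vect (R : numDomainType) (V : vectorLatticeType R)
    (x y : V) : Prop :=
  vmeet (vabs x) (vabs y) = 0.

Definition lattice_hom (R : numDomainType) (V W : vectorLatticeType R)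
    (f : V -> W) : Prop :=
  [/\ linear f, {morph f : x y / vjoin x y} & {morph f : x y / vmeet x y}].

HB.mixin Record VectorLattice_isBanachLattice (R : realType) X
    of CompleteNormedModule R X & VectorLattice R X := {
  bl_ler_norm : forall x y : X, vabs x <=v vabs y -> `|x| <= `|y|
}.

#[short(type="banachLatticeType")]
HB.structure Definition BanachLattice (R : realType) :=
  {X of CompleteNormedModule R X & VectorLattice R X
   & VectorLattice_isBanachLattice R X}.

(* Extended-real valued, so that no junk value arises for unbounded maps:
   [opnorm f] is finite if and only if the linear map [f] is bounded. *)
Definition opnorm (R : realType) (U V : normedModType R) (f : U -> V) : \bar R :=
  ereal_sup [set (`|f u|)%:E | u in [set u : U | `|u| <= 1]].

Record phfun (R : realType) (m : nat) := PHFun {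
  phfun_val :> 'rV[R]_m -> R ;
  phfun_cont : continuous phfun_val ;
  phfun_homo : forall (a : R) (t : 'rV[R]_m),
    0 <= a -> phfun_val (a *: t) = a * phfun_val t }.

Arguments phfun_cont {R m} p x : rename.
Arguments phfun_homo {R m} p [a] t : rename.

#[local] Obligation Tactic := idtac.

Section PHFunTheory.
Context {R : realType} {m : nat}.
Implicit Types f g h : phfun R m.

Lemma phfunP f g : (forall t, f t = g t) -> f = g.
Proof.
case: f g => [f cf hf] [g cg hg] /= fg.
have e : f = g by apply/funext.
by subst g; congr PHFun; exact: Prop_irrelevance.
Qed.

HB.instance Definition _ := gen_eqMixin (phfun R m).
HB.instance Definition _ := gen_choiceMixin (phfun R m).

Program Definition ph_zero : phfun R m := @PHFun R m (fun=> 0) _ _.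
Next Obligation. by move=> t; exact: cst_continuous. Qed.
Next Obligation. by move=> a t _; rewrite mulr0. Qed.

Program Definition ph_opp f : phfun R m := @PHFun R m (fun t => - f t) _ _.
Next Obligation. by move=> f t; apply: continuousN; exact: (phfun_cont f t). Qed.
Next Obligation. by move=> f a t a0 /=; rewrite phfun_homo// mulrN. Qed.

Program Definition ph_add f g : phfun R m :=
  @PHFun R m (fun t => f t + g t) _ _.
Next Obligation. by move=> f g t; apply: continuousD; [exact: (phfun_cont f t)|exact: (phfun_cont g t)]. Qed.
Next Obligation. by move=> f g a t a0 /=; rewrite !phfun_homo// mulrDr. Qed.

Program Definition ph_scale (c : R) f : phfun R m :=
  @PHFun R m (fun t => c * f t) _ _.
Next Obligation.
by move=> c f t; apply: continuousM; [exact: cst_continuous|exact: (phfun_cont f t)].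
Qed.
Next Obligation. by move=> c f a t a0 /=; rewrite phfun_homo// mulrCA. Qed.

Program Definition ph_join f g : phfun R m :=
  @PHFun R m (fun t => Num.max (f t) (g t)) _ _.
Next Obligation.
by move=> f g t; apply: continuous_max; [exact: (phfun_cont f t)|exact: (phfun_cont g t)].
Qed.
Next Obligation. by move=> f g a t a0 /=; rewrite !phfun_homo// maxr_pMr. Qed.

Program Definition ph_meet f g : phfun R m :=
  @PHFun R m (fun t => Num.min (f t) (g t)) _ _.
Next Obligation.
by move=> f g t; apply: continuous_min; [exact: (phfun_cont f t)|exact: (phfun_cont g t)].
Qed.
Next Obligation. by move=> f g a t a0 /=; rewrite !phfun_homo// minr_pMr. Qed.

Fact ph_addA : associative ph_add.
Proof. by move=> f g h; apply: phfunP => t /=; rewrite addrA. Qed.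
Fact ph_addC : commutative ph_add.
Proof. by move=> f g; apply: phfunP => t /=; rewrite addrC. Qed.
Fact ph_add0 : left_id ph_zero ph_add.
Proof. by move=> f; apply: phfunP => t /=; rewrite add0r. Qed.
Fact ph_addN : left_inverse ph_zero ph_opp ph_add.
Proof. by move=> f; apply: phfunP => t /=; rewrite addNr. Qed.

HB.instance Definition _ :=
  GRing.isZmodule.Build (phfun R m) ph_addA ph_addC ph_add0 ph_addN.

Fact ph_scaleA (a b : R) f : ph_scale a (ph_scale b f) = ph_scale (a * b) f.
Proof. by apply: phfunP => t /=; rewrite mulrA. Qed.
Fact ph_scale1 : left_id 1 ph_scale.
Proof. by move=> f; apply: phfunP => t /=; rewrite mul1r. Qed.
Fact ph_scaleDr : right_distributive ph_scale +%R.
Proof. by move=> a f g; apply: phfunP => t /=; rewrite mulrDr. Qed.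
Fact ph_scaleDl f : {morph ph_scale^~ f : a b / a + b}.
Proof. by move=> a b; apply: phfunP => t /=; rewrite mulrDl. Qed.

HB.instance Definition _ := GRing.Zmodule_isLmodule.Build R (phfun R m)
  ph_scaleA ph_scale1 ph_scaleDr ph_scaleDl.

Definition ph_le f g : bool := `[< forall t, f t <= g t >].

Fact ph_le_refl : reflexive ph_le.
Proof. by move=> f; apply/asboolP. Qed.
Fact ph_le_anti : antisymmetric ph_le.
Proof.
move=> f g /andP[/asboolP fg /asboolP gf].
by apply: phfunP => t; apply/eqP; rewrite eq_le fg gf.
Qed.
Fact ph_le_trans : transitive ph_le.
Proof.
move=> g f h /asboolP fg /asboolP gh; apply/asboolP => t.
exact: le_trans (fg t) (gh t).
Qed.

Fact ph_le_join f g h : ph_le (ph_join f g) h = ph_le f h && ph_le g h.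
Proof.
apply/asboolP/andP => [fgh|[/asboolP fh /asboolP gh] t /=].
  by split; apply/asboolP => t; have := fgh t; rewrite /= ge_max => /andP[].
by rewrite ge_max fh gh.
Qed.
Fact ph_le_meet f g h : ph_le h (ph_meet f g) = ph_le h f && ph_le h g.
Proof.
apply/asboolP/andP => [hfg|[/asboolP hf /asboolP hg] t /=].
  by split; apply/asboolP => t; have := hfg t; rewrite /= le_min => /andP[].
by rewrite le_min hf hg.
Qed.

Fact ph_le_addr h f g : ph_le f g -> ph_le (f + h) (g + h).
Proof. by move=> /asboolP fg; apply/asboolP => t /=; rewrite lerD2r. Qed.
Fact ph_le_scale (a : R) f : 0 <= a -> ph_le 0 f -> ph_le 0 (a *: f).
Proof.
by move=> a0 /asboolP f0; apply/asboolP => t /=; rewrite mulr_ge0//; exact: f0.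
Qed.

HB.instance Definition _ := Lmodule_isVectorLattice.Build R (phfun R m)
  ph_le_refl ph_le_anti ph_le_trans ph_le_join ph_le_meet ph_le_addr
  ph_le_scale.

Program Definition ph_coord (k : 'I_m) : phfun R m :=
  @PHFun R m (fun t => t ord0 k) _ _.
Next Obligation. by move=> k; exact: coord_continuous. Qed.
Next Obligation. by move=> k a t _ /=; rewrite mxE. Qed.

End PHFunTheory.

Definition ph_monotone (R : realType) (m : nat) (h : phfun R m) : Prop :=
  forall t s : 'rV[R]_m,
    (forall k, 0 <= t ord0 k <= s ord0 k) -> h t <= h s.

(* By Krivine's theorem the set below is a singleton, so the default value of
   [xget] is never used. *)
Definition func_calc (R : realType) (X : banachLatticeType R) (m : nat)
    (x : 'I_m -> X) : phfun R m -> X :=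
  xget (fun=> 0) [set Phi : phfun R m -> X |
    lattice_hom Phi /\ forall k, Phi (ph_coord k) = x k].

(* [cc_M] and [cc_theta] are only meaningful on [cc_set];
   [cc_theta] takes values in {0, 1} = {false, true}. *)
Record convexity_condition (R : realType) := ConvexityCondition {
  cc_set : forall m, set (phfun R m) ;
  cc_nonempty : exists m (g : phfun R m), cc_set g ;
  cc_arity_gt0 : forall m (g : phfun R m), cc_set g -> (0 < m)%N ;
  cc_monotone : forall m (g : phfun R m), cc_set g -> ph_monotone g ;
  cc_M : forall m, phfun R m -> R ;
  cc_M_ge1 : forall m (g : phfun R m), cc_set g -> 1 <= cc_M g ;
  cc_theta : forall m, phfun R m -> bool }.

Definition convex_for (R : realType) (D : convexity_condition R)
    (X : banachLatticeType R) : Prop :=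
  forall (m : nat) (g : phfun R m), cc_set D g ->
  forall x : 'I_m -> X,
    (forall k, 0 <=v x k) ->
    (~~ cc_theta D g -> forall j k, j != k -> disjoint_vect (x j) (x k)) ->
    `|func_calc x g| <= cc_M D g * g (\row_k `|x k|).

(* Main.v *)
Require Import Defs.
From HB Require Import structures.
From mathcomp Require Import all_boot all_order all_algebra.
From mathcomp Require Import all_classical all_reals all_analysis.
From mathcomp Require Import lra.

Set Implicit Arguments.
Unset Strict Implicit.
Unset Printing Implicit Defensive.

Import Order.TTheory GRing.Theory Num.Theory.
Import numFieldNormedType.Exports.

Local Open Scope classical_set_scope.
Local Open Scope ring_scope.


(** Let a representation be a contraction [i : E -> X_i] into a [D]-convex
    Banach lattice.  Every vector lattice expression [t] with variables in [E]
    has a value [interp i t] in [X_i], and by induction on [t] these values are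
    bounded uniformly in [i].  The supremum over [i] of the norms of the values
    is therefore a lattice seminorm on expressions, and the free lattice is the
    Hausdorff completion of the expressions under it.  Concretely, its elements
    are uniformly Cauchy sequences of expressions, two sequences being equal
    when they have the same limit in every [X_i].  The evaluations
    [FBL_eval i : FBL -> X_i] are jointly injective, so that all the axioms of
    a Banach lattice are read off from the [X_i].

    - Convexity.  Two lattice homomorphisms on the positively homogeneous
      functions agree as soon as they agree on the coordinates
      ([lattice_hom_phfun_eq]), because lattice-linear expressions in the
      coordinates are uniformly dense on the sphere (the lattice form of the
      Stone-Weierstrass theorem).  Hence the evaluations commute with the
      functional calculus, and since [g] is monotone the inequality in [FBL]
      is the supremum of the inequalities in the [X_i] ([FBL_convex]).
    - Isometry.  The real line is [D]-convex for every [D], so that norming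
      functionals on [E], given by the Hahn-Banach theorem, are representations
      ([norming_representation]).
    - Universality.  An operator [T] of norm at most [c > 0] is [c] times a
      representation [i], and [c *: FBL_eval i] extends it with norm at most
      [c] ([FBL_extension]).
    - Uniqueness.  Expressions are dense in [FBL], and a lattice homomorphism
      between Banach lattices is determined by its values on a dense set
      ([lattice_hom_eq_dense]).  The extensions obtained for the various [c]
      therefore coincide, which gives the equality of the operator norms. *)

(** * Vector lattices *)

Section VectorLatticeTheory.
Context {R : numFieldType} {V : vectorLatticeType R}.
Implicit Types x y z t : V.

Lemma vle_eq x y : x <=v y -> y <=v x -> x = y.
Proof. by move=> xy yx; apply: vle_anti; rewrite xy yx. Qed.

Lemma vle_joinl x y : x <=v vjoin x y.
Proof.
by have := vle_join x y (vjoin x y); rewrite vle_refl => /esym/andP[].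
Qed.

Lemma vle_joinr x y : y <=v vjoin x y.
Proof.
by have := vle_join x y (vjoin x y); rewrite vle_refl => /esym/andP[].
Qed.

Lemma vjoin_le x y z : x <=v z -> y <=v z -> vjoin x y <=v z.
Proof. by rewrite vle_join => -> ->. Qed.

Lemma vle_meetl x y : vmeet x y <=v x.
Proof.
by have := vle_meet x y (vmeet x y); rewrite vle_refl => /esym/andP[].
Qed.

Lemma vle_meetr x y : vmeet x y <=v y.
Proof.
by have := vle_meet x y (vmeet x y); rewrite vle_refl => /esym/andP[].
Qed.

Lemma vle_add x y z t : x <=v y -> z <=v t -> x + z <=v y + t.
Proof.
move=> xy zt; apply: (@vle_trans _ _ (y + z)); first exact: vle_addr.
by rewrite ![y + _]addrC; exact: vle_addr.
Qed.

Lemma vsubr_ge0 x y : (0 <=v y - x) = (x <=v y).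
Proof.
apply/idP/idP => h; last by have := vle_addr (- x) _ _ h; rewrite subrr.
by have := vle_addr x _ _ h; rewrite add0r subrK.
Qed.

Lemma vle_opp x y : (- x <=v - y) = (y <=v x).
Proof. by rewrite -vsubr_ge0 opprK addrC vsubr_ge0. Qed.

Lemma vle_scalel (a : R) x y : 0 <= a -> x <=v y -> a *: x <=v a *: y.
Proof.
by move=> a0; rewrite -[x <=v y]vsubr_ge0 -[_ *: _ <=v _]vsubr_ge0 -scalerBr;
  exact: vle_scale.
Qed.

Lemma vjoinC x y : vjoin x y = vjoin y x.
Proof.
by apply: vle_eq; apply: vjoin_le; rewrite ?vle_joinl ?vle_joinr.
Qed.

Lemma vjoin_idPr x y : (vjoin x y = y) <-> (x <=v y).
Proof.
split=> [<-|xy]; first exact: vle_joinl.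
by apply: vle_eq (vle_joinr _ _); apply: vjoin_le => //; exact: vle_refl.
Qed.

Lemma vmeet_opp_join x y : vmeet x y = - vjoin (- x) (- y).
Proof.
apply: vle_eq.
  by rewrite -[vmeet x y]opprK vle_opp; apply: vjoin_le;
    rewrite vle_opp ?vle_meetl ?vle_meetr.
by rewrite vle_meet -{2}[x]opprK -{3}[y]opprK !vle_opp vle_joinl vle_joinr.
Qed.

Lemma vjoin_scale (a : R) x y :
  0 <= a -> vjoin (a *: x) (a *: y) = a *: vjoin x y.
Proof.
rewrite le_eqVlt => /predU1P[<-|a0].
  by rewrite !scale0r; apply/vjoin_idPr; exact: vle_refl.
apply: vle_eq.
  by apply: vjoin_le; apply: vle_scalel; rewrite ?ltW ?vle_joinl ?vle_joinr.
rewrite -[vjoin (_ *: _) _](scalerKV (lt0r_neq0 a0)).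
apply: vle_scalel; first exact: ltW.
by apply: vjoin_le; rewrite -[X in X <=v _](scalerK (lt0r_neq0 a0));
  apply: vle_scalel; rewrite ?invr_ge0 ?ltW ?vle_joinl ?vle_joinr.
Qed.

Lemma vabs_le x y : (vabs x <=v y) = (x <=v y) && (- x <=v y).
Proof. exact: vle_join. Qed.

Lemma vle_abs x : x <=v vabs x. Proof. exact: vle_joinl. Qed.

Lemma vabsN x : vabs (- x) = vabs x.
Proof. by rewrite /vabs opprK vjoinC. Qed.

Lemma vabs_ge0 x : 0 <=v vabs x.
Proof.
rewrite -[vabs x](@scalerK _ _ (2%:R : R)) ?pnatr_eq0//.
apply: vle_scale; first by rewrite invr_ge0 ler0n.
rewrite scaler_nat mulr2n -(subrr x).
by apply: vle_add; [exact: vle_abs|rewrite -vabsN; exact: vle_abs].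
Qed.

Lemma vabs_pos x : 0 <=v x -> vabs x = x.
Proof.
move=> x0; rewrite /vabs vjoinC; apply/vjoin_idPr.
by apply: (@vle_trans _ _ 0) => //; rewrite -[0]oppr0 vle_opp.
Qed.

Lemma vabs_id x : vabs (vabs x) = vabs x.
Proof. by apply: vabs_pos; exact: vabs_ge0. Qed.

Lemma vsub_le x y z : (x - y <=v z) = (x <=v y + z).
Proof. by rewrite -vsubr_ge0 -[x <=v _]vsubr_ge0 opprB addrCA addrA. Qed.

Lemma vle_join_dist x y z t :
  vabs (vjoin x y - vjoin z t) <=v vabs (x - z) + vabs (y - t).
Proof.
have le x' y' z' t' :
    vjoin x' y' - vjoin z' t' <=v vabs (x' - z') + vabs (y' - t').
  rewrite vsub_le; apply: vjoin_le.
    rewrite -[X in X <=v _](subrKC z'); apply: vle_add (vle_joinl _ _) _.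
    by rewrite -[X in X <=v _]addr0; apply: vle_add (vle_abs _) (vabs_ge0 _).
  rewrite -[X in X <=v _](subrKC t'); apply: vle_add (vle_joinr _ _) _.
  by rewrite -[X in X <=v _]add0r; apply: vle_add (vabs_ge0 _) (vle_abs _).
rewrite vabs_le le opprB; apply/andP; split=> //.
by rewrite -(vabsN (x - z)) -(vabsN (y - t)) !opprB.
Qed.

End VectorLatticeTheory.

Section LatticeHom.
Context {R : numFieldType}.
Implicit Types U V W : vectorLatticeType R.

(** Meets are expressed by joins and opposites in any vector lattice. *)
Lemma lattice_hom_linear U V (f : U -> V) :
  linear f -> {morph f : x y / vjoin x y} -> lattice_hom f.
Proof.
move=> lf jf; split=> // x y.
have fN z : f (- z) = - f z.
  have f0 : f 0 = 0.
    by have := lf (-1) 0 0; rewrite scaler0 addr0 scaleN1r addNr.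
  by have := lf (-1) z 0; rewrite addr0 f0 addr0 !scaleN1r.
by rewrite !vmeet_opp_join fN jf !fN.
Qed.

Lemma lattice_hom_comp U V W (f : V -> W) (g : U -> V) :
  lattice_hom f -> lattice_hom g -> lattice_hom (f \o g).
Proof.
move=> [fl fj fm] [gl gj gm]; split=> [a x y|x y|x y] /=.
- by rewrite gl fl.
- by rewrite gj fj.
- by rewrite gm fm.
Qed.

Section Theory.
Context {U V : vectorLatticeType R} {f : U -> V}.
Hypothesis fhom : lattice_hom f.
Implicit Types x y : U.

Lemma lhomD x y : f (x + y) = f x + f y.
Proof. by case: fhom => lf _ _; have := lf 1 x y; rewrite !scale1r. Qed.

Lemma lhom0 : f 0 = 0.
Proof. by apply: (addrI (f 0)); rewrite -lhomD !addr0. Qed.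

Lemma lhomZ a x : f (a *: x) = a *: f x.
Proof.
case: fhom => lf _ _; have := lf a x 0.
by rewrite addr0 => ->; rewrite lhom0 addr0.
Qed.

Lemma lhomN x : f (- x) = - f x.
Proof. by rewrite -scaleN1r lhomZ scaleN1r. Qed.

Lemma lhomB x y : f (x - y) = f x - f y.
Proof. by rewrite lhomD lhomN. Qed.

Lemma lhom_join x y : f (vjoin x y) = vjoin (f x) (f y).
Proof. by case: fhom. Qed.

Lemma lhom_meet x y : f (vmeet x y) = vmeet (f x) (f y).
Proof. by case: fhom. Qed.

Lemma lhom_abs x : f (vabs x) = vabs (f x).
Proof. by rewrite /vabs lhom_join lhomN. Qed.

Lemma lhom_le x y : x <=v y -> f x <=v f y.
Proof.
by move=> /vjoin_idPr xy; apply/vjoin_idPr; rewrite -lhom_join xy.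
Qed.

End Theory.
End LatticeHom.

(** * Banach lattices *)

Section BanachLatticeTheory.
Context {R : realType} {X : banachLatticeType R}.
Implicit Types x y z : X.

Lemma norm_vabs x : `|vabs x| = `|x|.
Proof.
by apply/eqP; rewrite eq_le !bl_ler_norm// vabs_id; exact: vle_refl.
Qed.

Lemma ler_norm_vabs x y : vabs x <=v y -> `|x| <= `|y|.
Proof.
move=> xy; apply: bl_ler_norm; rewrite (@vabs_pos _ _ y)//.
exact: vle_trans (vabs_ge0 x) xy.
Qed.

Lemma ler_norm_join x y z t :
  `|vjoin x y - vjoin z t| <= `|x - z| + `|y - t|.
Proof.
apply: le_trans (ler_norm_vabs (vle_join_dist x y z t)) _.
by rewrite -(norm_vabs (x - z)) -(norm_vabs (y - t)); exact: ler_normD.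
Qed.

Lemma cvg_vjoin T (F : set_system T) (FF : Filter F) (f g : T -> X) x y :
  f @ F --> x -> g @ F --> y -> vjoin (f t) (g t) @[t --> F] --> vjoin x y.
Proof.
move=> fx gy; apply/cvgrPdist_le => e e0.
have e20 : 0 < e / 2 by rewrite divr_gt0.
have /cvgrPdist_le/(_ _ e20) Ff := fx.
have /cvgrPdist_le/(_ _ e20) Fg := gy.
near=> t; apply: le_trans (ler_norm_join _ _ _ _) _.
by rewrite (splitr e) lerD//; near: t.
Unshelve. all: by end_near. Qed.

Lemma cvg_vge0 (u : nat -> X) x :
  (forall n, 0 <=v u n) -> u @ \oo --> x -> 0 <=v x.
Proof.
move=> u0 ux; apply/vjoin_idPr.
apply: (@cvg_unique _ (@norm_hausdorff _ X) (u @ \oo)) => //.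
suff <- : (fun n => vjoin 0 (u n)) = u.
  by apply: cvg_vjoin => //; exact: cvg_cst.
by apply/funext => n; apply/vjoin_idPr.
Qed.

(** Fast norm convergence is relatively uniform: summing [2 ^+ n *: vabs (y n)]
    gives a single element that controls the whole sequence in order.  Order
    estimates survive under lattice homomorphisms, even when these are not known
    to be continuous. *)
Lemma geometric_dominated (y : nat -> X) :
  (forall n, `|y n| <= 4^-1 ^+ n) ->
  exists w : X, forall n, vabs (y n) <=v 2^-1 ^+ n *: w.
Proof.
move=> ysmall; pose v n := 2 ^+ n *: vabs (y n).
have v0 n : 0 <=v v n by apply: vle_scale; [exact: exprn_ge0|exact: vabs_ge0].
have vcvg : cvgn (series v).
  apply: normed_cvg; apply: (@series_le_cvg _ _ (geometric 1 2^-1)) => [n|n|n|].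
  - exact: normr_ge0.
  - by rewrite /geometric /= mul1r exprn_ge0// invr_ge0.
  - rewrite /geometric /= mul1r normrZ norm_vabs ger0_norm ?exprn_ge0//.
    apply: le_trans (ler_wpM2l _ (ysmall n)) _; first exact: exprn_ge0.
    by rewrite -exprMn (_ : 2 * 4^-1 = 2^-1)//; lra.
  - by apply: is_cvg_geometric_series; rewrite ger0_norm ?invr_ge0//; lra.
have sum0 k l : 0 <=v \sum_(k <= i < l) v i.
  elim/big_ind: _ => [|x z x0 z0|i _ //]; first exact: vle_refl.
  by rewrite -[0]addr0; exact: vle_add.
exists (limn (series v)) => n.
rewrite -[vabs (y n)](@scalerK _ _ (2 ^+ n : R)) ?expf_neq0// -exprVn.
apply: vle_scalel; first by rewrite exprn_ge0// invr_ge0.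
rewrite -vsubr_ge0; apply: (@cvg_vge0 (fun k => series v (k + n.+1)%N - v n)).
  move=> k; rewrite /series /= (@big_cat_nat _ _ _ n) //=; last first.
    by rewrite addnS ltnW// ltnS leq_addl.
  rewrite (@big_ltn _ _ _ n); last by rewrite addnS ltnS leq_addl.
  by rewrite addrCA [v n + _]addrC addrK -[X in X <=v _]addr0; apply: vle_add.
apply: cvgB; last exact: cvg_cst.
by rewrite (cvg_shiftn n.+1).
Qed.

End BanachLatticeTheory.

(** A lattice homomorphism is order preserving, so that it respects relatively
    uniform convergence. *)
Lemma lattice_hom_eq_dense (R : realType) (X Y : banachLatticeType R)
    (S T : X -> Y) (A : set X) :
  lattice_hom S -> lattice_hom T ->
  (forall x e, 0 < e -> exists2 a, A a & `|x - a| <= e) ->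
  (forall a, A a -> S a = T a) -> S = T.
Proof.
move=> Sh Th Ad ST; apply/funext => x.
have /choice [a a_x] n : exists b, A b /\ `|x - b| <= 4^-1 ^+ n.
  have [|b Ab xb] := Ad x (4^-1 ^+ n); last by exists b.
  by rewrite exprn_gt0// invr_gt0.
have [w wP] := geometric_dominated (fun n => (a_x n).2).
have close (U : X -> Y) n : lattice_hom U ->
    `|U x - U (a n)| <= 2^-1 ^+ n * `|U w|.
  move=> Uh; rewrite -lhomB//.
  have := lhom_le Uh (wP n); rewrite lhom_abs// lhomZ// => /ler_norm_vabs.
  by rewrite normrZ ger0_norm// exprn_ge0// invr_ge0.
apply/eqP; rewrite -subr_eq0 -normr_le0.
have : (2^-1 ^+ n * (`|S w| + `|T w|)) @[n --> \oo] --> (0 : R).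
  rewrite -[0](mul0r (`|S w| + `|T w|)); apply: cvgMl.
  by apply: cvg_expr; rewrite ger0_norm ?invr_ge0//; lra.
move=> /cvgr_to_ge; apply; near=> n.
have -> : S x - T x = (S x - S (a n)) - (T x - T (a n)).
  by rewrite (ST _ (a_x n).1) opprB addrA subrK.
by rewrite mulrDr (le_trans (ler_normB _ _))// lerD// close.
Unshelve. all: by end_near. Qed.

(** * Density of lattice-linear functions and the functional calculus *)

(** The compactness argument of the Stone-Weierstrass theorem, in a form that
    serves both for its upper and for its lower bounds: a directed open cover
    of a compact set has a member that contains the whole set. *)
Lemma compact_directed_cover (T : ptopologicalType) (I : choiceType)
    (K : set T) (A : set I) (U : I -> set T) :
  compact K -> (forall i, open (U i)) -> A !=set0 ->
  (forall i j, A i -> A j -> exists2 k, A k & U i `|` U j `<=` U k) ->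
  (forall t, K t -> exists2 i, A i & U i t) ->
  exists2 i, A i & K `<=` U i.
Proof.
rewrite compact_cover => Kc Uo [i0 Ai0] Adir KU.
have [|t /KU[i Ai Ut]|D' D'A KD'] := Kc I A U.
- by move=> *; exact: Uo.
- by exists i.
have [k Ak D'k] : exists2 k, A k &
    forall i, i \in finmap.enum_fset D' -> U i `<=` U k.
  have : forall i, i \in finmap.enum_fset D' -> A i by move=> i /D'A/set_mem.
  elim: (finmap.enum_fset D') => [_|i s IHs sA]; first by exists i0.
  have [|k Ak sk] := IHs; first by move=> j js; apply: sA; rewrite inE js orbT.
  have [l Al kl] := Adir i k (sA i (mem_head _ _)) Ak.
  exists l => // j; rewrite inE => /predU1P[->|/sk jk] t jt; apply: kl.
    by left.
  by right; exact: jk.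
by exists k => // t /KD'[i iD' Ut]; exact: (D'k i iD').
Qed.

Section PHFunEval.
Context {R : realType} {m : nat}.
Implicit Types (f g : phfun R m) (t : 'rV[R]_m).

Lemma phfun_addE f g t : (f + g) t = f t + g t. Proof. by []. Qed.
Lemma phfun_oppE f t : (- f) t = - f t. Proof. by []. Qed.
Lemma phfun_scaleE a f t : (a *: f) t = a * f t. Proof. by []. Qed.
Lemma phfun_joinE f g t : vjoin f g t = Num.max (f t) (g t). Proof. by []. Qed.
Lemma phfun_absE f t : vabs f t = `|f t|.
Proof. by rewrite -maxrN. Qed.

Definition phfunE :=
  (phfun_addE, phfun_oppE, phfun_scaleE, phfun_joinE, phfun_absE).

Lemma phfun0 f : f 0 = 0.
Proof. by have := phfun_homo f 0 (lexx 0); rewrite scale0r mul0r. Qed.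

End PHFunEval.

Section PHFunDensity.
Context {R : realType} {m : nat} (A : set (phfun R m)).
Implicit Types f g h : phfun R m.
Hypothesis A_coord : forall k, A (ph_coord k).
Hypothesis A_add : forall f g, A f -> A g -> A (f + g).
Hypothesis A_scale : forall a f, A f -> A (a *: f).
Hypothesis A_join : forall f g, A f -> A g -> A (vjoin f g).

Let A_opp f : A f -> A (- f).
Proof. by rewrite -scaleN1r; exact: A_scale. Qed.

Let A_meet f g : A f -> A g -> A (vmeet f g).
Proof.
by move=> Af Ag; rewrite vmeet_opp_join; apply/A_opp/A_join; exact: A_opp.
Qed.

(** Up to homogeneity, two nonzero points are either linearly independent,
    on one half-line, or on two opposite half-lines; the coordinates and their
    positive and negative parts suffice in each case. *)
Lemma phfun_interpolation h s t :
  A !=set0 -> exists f, [/\ A f, f s = h s & f t = h t].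
Proof.
move=> [f0 Af0]; have A0 : A 0 by rewrite -(scale0r f0); exact: A_scale.
case: (eqVneq s 0) => [->|s0].
  case: (eqVneq t 0) => [->|t0].
    by exists 0; split=> //; rewrite !phfun0.
  have [k tk] : exists k, t ord0 k != 0.
    apply/not_existsP => tk; move/eqP: t0; apply; apply/rowP => k.
    by rewrite mxE; apply/eqP/negPn/negP; exact: tk.
  exists ((h t / t ord0 k) *: ph_coord k); split.
  - exact/A_scale/A_coord.
  - by rewrite !phfun0.
  - by rewrite /= divfK.
have [k sk] : exists k, s ord0 k != 0.
  apply/not_existsP => sk; move/eqP: s0; apply; apply/rowP => k.
  by rewrite mxE; apply/eqP/negPn/negP; exact: sk.
have [c [Ac cs]] : exists c, A c /\ c s = 1.
  exists ((s ord0 k)^-1 *: ph_coord k); split; first exact/A_scale/A_coord.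
  by rewrite /= mulVf.
case: (pselect (exists j, t ord0 j != c t * s ord0 j)) => [[j tj]|tcs].
  (* [s] and [t] are linearly independent: correct [h s *: c], which is right
     at [s], by a multiple of a linear form [l] that vanishes there *)
  have [l [Al ls lt]] : exists l, [/\ A l, l s = 0 & l t != 0].
    exists (ph_coord j - s ord0 j *: c); split.
    - by apply: A_add; [exact: A_coord|exact/A_opp/A_scale].
    - by rewrite !phfunE cs mulr1 subrr.
    - by rewrite !phfunE subr_eq0 mulrC.
  exists (h s *: c + ((h t - h s * c t) / l t) *: l); split.
  - by apply: A_add; exact: A_scale.
  - by rewrite !phfunE cs ls mulr1 mulr0 addr0.
  - by rewrite !phfunE divfK// subrKC.
have {}tcs : t = c t *: s.
  apply/rowP => j; rewrite [RHS]mxE; apply/eqP/negPn/negP => tj; apply: tcs.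
  by exists j.
case: (lerP 0 (c t)) => [ct0|ct0].
  exists (h s *: c); split=> //; first exact: A_scale.
    by rewrite !phfunE cs mulr1.
  by rewrite !phfunE [in RHS]tcs phfun_homo// mulrC.
(* [t] is a negative multiple of [s]: the two opposite half-lines are separated
   by the positive and the negative part of [c] *)
exists (h s *: vjoin c 0 + (h t / - c t) *: vjoin (- c) 0); split.
- by apply: A_add; apply/A_scale/A_join => //; exact: A_opp.
- rewrite !phfunE cs max_l// max_r ?mulr1 ?mulr0 ?addr0//.
  by rewrite lerN10.
- rewrite !phfunE max_r ?mulr0 ?add0r ?ltW// max_l ?oppr_ge0 ?ltW//.
  by rewrite divfK// oppr_eq0 lt_eqF.
Qed.

Lemma sphere_compact : compact [set t : 'rV[R]_m | `|t| = 1].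
Proof.
apply: bounded_closed_compact.
  by exists 1; split=> // M M1 t /= ->; exact: ltW.
apply: (@closed_comp _ _ (fun t : 'rV[R]_m => `|t|) [set 1]).
  by move=> t _; exact: norm_continuous.
exact: closed_eq.
Qed.

Let phfun_open (f g : phfun R m) e : open [set t | f t < g t + e].
Proof.
have -> : [set t | f t < g t + e] =
    (fun t => g t - f t) @^-1` [set x | - e < x].
  by apply/seteqP; split=> t /=; lra.
apply: open_comp; last exact: open_gt.
by move=> t _; apply: continuousB; exact: phfun_cont.
Qed.

(** Two applications of compactness: the meets of functions that interpolate
    [h] at [s] bring them below [h + e] everywhere, and the joins over [s] of
    the results bring them above [h - e]. *)
Lemma phfun_sphere_dense h e : A !=set0 -> 0 < e ->
  exists2 f, A f & forall t, `|t| = 1 -> `|h t - f t| <= e.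
Proof.
move=> A0 e0.
have above s : exists2 f, A f /\ f s = h s &
    [set t | `|t| = 1] `<=` [set t | f t < h t + e].
  apply: (@compact_directed_cover _ _ _ [set f | A f /\ f s = h s]
    (fun f => [set t | f t < h t + e])) => [|f||f g [Af fs] [Ag gs]|t _].
  - exact: sphere_compact.
  - exact: phfun_open.
  - by have [f [Af fs _]] := phfun_interpolation h s s A0; exists f.
  - exists (vmeet f g); first by split; [exact: A_meet|rewrite /= fs gs minxx].
    by move=> t [] /= ft; rewrite gt_min ft ?orbT.
  - have [f [Af fs ft]] := phfun_interpolation h s t A0.
    by exists f => //=; rewrite ft; lra.
have [f [Af fle] fge] : exists2 f,
    A f /\ [set t | `|t| = 1] `<=` [set t | f t < h t + e] &
    [set t | `|t| = 1] `<=` [set t | h t < f t + e].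
  apply: (@compact_directed_cover _ _ _ [set f |
      A f /\ [set t | `|t| = 1] `<=` [set t | f t < h t + e]]
    (fun f => [set t | h t < f t + e])) => [|f||f g [Af fh] [Ag gh]|t _].
  - exact: sphere_compact.
  - exact: phfun_open.
  - by have [f [Af _] fh] := above 0; exists f.
  - exists (vjoin f g).
      split; [exact: A_join|move=> t t1 /=].
      by rewrite gt_max; apply/andP; split; [exact: fh|exact: gh].
    move=> t [] /= ?; rewrite -ltrBlDr lt_max !ltrBlDr; apply/orP.
      by left.
    by right.
  - have [f [Af ft] fh] := above t.
    by exists f => //=; rewrite ft; lra.
exists f => // t t1; rewrite ler_norml.
by have /= := fle t t1; have /= := fge t t1; lra.
Qed.

(** Homogeneity turns uniform approximation on the sphere into an estimate for
    the order of the vector lattice of homogeneous functions, which lattice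
    homomorphisms preserve. *)
Lemma phfun_order_dense h e : A !=set0 -> 0 < e ->
  exists2 f, A f & vabs (h - f) <=v e *: \sum_k vabs (ph_coord k).
Proof.
move=> A0 e0; have [f Af hf] := phfun_sphere_dense h A0 e0.
exists f => //; apply/asboolP => t.
have sumE : (\sum_k vabs (ph_coord k)) t = \sum_k `|t ord0 k|.
  elim/big_ind2: _ => // [g x g' x' <- <-|k _]; first exact: phfun_addE.
  exact: phfun_absE.
rewrite !phfunE sumE.
case: (eqVneq t 0) => [->|t0].
  rewrite !phfun0 subrr normr0.
  by apply: mulr_ge0; [exact: ltW|exact: sumr_ge0].
have nt : `|t| != 0 by rewrite normr_eq0.
have [s s1 ts] : exists2 s, `|s| = 1 & t = `|t| *: s.
  exists (`|t|^-1 *: t); first by rewrite normrZ normfV normr_id mulVf.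
  by rewrite scalerA divff// scale1r.
have -> : h t - f t = `|t| * (h s - f s).
  by rewrite {1 2}ts !phfun_homo// mulrBr.
have tsum : `|t| <= \sum_k `|t ord0 k|.
  rewrite [`|t|]mx_normrE; apply/bigmax_leP; split; first exact: sumr_ge0.
  move=> [i k] _ /=; rewrite (ord1 i) (bigD1 k) //= lerDl.
  exact: sumr_ge0.
by rewrite normrM normr_id mulrC ler_pM// hf.
Qed.

End PHFunDensity.

(** The uniqueness half of the functional calculus: the set where [Phi] and
    [Psi] agree contains the coordinates and is a vector sublattice, hence it is
    dense in the sense of [phfun_order_dense]. *)
Lemma lattice_hom_phfun_eq (R : realType) (X : banachLatticeType R) m
    (Phi Psi : phfun R m -> X) :
  lattice_hom Phi -> lattice_hom Psi ->
  (forall k, Phi (ph_coord k) = Psi (ph_coord k)) -> Phi = Psi.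
Proof.
move=> Phih Psih PhiPsi; apply/funext => h.
pose A := [set f | Phi f = Psi f].
have Aadd f g : A f -> A g -> A (f + g).
  by rewrite /A /= => fE gE; rewrite !lhomD// fE gE.
have Ascale a f : A f -> A (a *: f) by rewrite /A /= => fE; rewrite !lhomZ// fE.
have Ajoin f g : A f -> A g -> A (vjoin f g).
  by rewrite /A /= => fE gE; rewrite !lhom_join// fE gE.
have A0 : A 0 by rewrite /A /= !lhom0.
pose N : phfun R m := \sum_k vabs (ph_coord k).
have AN : A N.
  rewrite /A /=; elim/big_ind: N => // k _.
  by rewrite !lhom_abs// PhiPsi.
apply/eqP; rewrite -subr_eq0 -normr_le0; apply/ler_addgt0Pr => e e0.
pose d := e / (2 * (`|Phi N| + 1)).
have d0 : 0 < d by rewrite divr_gt0// mulr_gt0// ltr_wpDl.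
have [f Af hf] :=
  phfun_order_dense PhiPsi Aadd Ascale Ajoin h (ex_intro _ _ A0) d0.
have close (U : phfun R m -> X) : lattice_hom U -> `|U h - U f| <= d * `|U N|.
  move=> Uh; rewrite -lhomB//; have := lhom_le Uh hf.
  rewrite lhom_abs// lhomZ// => /ler_norm_vabs.
  by rewrite normrZ gtr0_norm.
have -> : Phi h - Psi h = (Phi h - Phi f) - (Psi h - Psi f).
  by rewrite Af opprB addrA subrK.
apply: le_trans (ler_normB _ _) _; rewrite add0r.
apply: le_trans (lerD (close _ Phih) (close _ Psih)) _.
have : d * (2 * (`|Phi N| + 1)) = e.
  by rewrite divfK// mulf_neq0// gt_eqF// ltr_wpDl.
by rewrite -AN; lra.
Qed.

Lemma func_calcE (R : realType) (X : banachLatticeType R) m (x : 'I_m -> X)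
    (Phi : phfun R m -> X) :
  lattice_hom Phi -> (forall k, Phi (ph_coord k) = x k) -> func_calc x = Phi.
Proof.
move=> Phih Phix; rewrite /func_calc.
case: xgetP => [Psi _ [Psih Psix]|/(_ Phi)].
  by apply: lattice_hom_phfun_eq => // k; rewrite Phix.
by case.
Qed.

(** Composing a functional calculus at [x] with [f] gives one at [f \o x], which
    is then the functional calculus there by uniqueness.  The first alternative
    is the default value of [func_calc]. *)
Lemma lhom_func_calc (R : realType) (X Y : banachLatticeType R) (f : X -> Y) m
    (x : 'I_m -> X) (g : phfun R m) :
  lattice_hom f ->
  func_calc x g = 0 \/ f (func_calc x g) = func_calc (f \o x) g.
Proof.
move=> fh; rewrite {1 2}/func_calc.
case: xgetP => [Phi _ [Phih Phix]|_]; [right|by left].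
rewrite (@func_calcE _ _ _ _ (f \o Phi))//; first exact: lattice_hom_comp.
by move=> k /=; rewrite Phix.
Qed.


(** * Norming functionals *)

Section HahnBanach.
Context {R : realType} {E : normedModType R}.
Implicit Types (x y u : E) (r s a : R) (G : set (E * R)).

(** Graphs of linear functionals on subspaces of [E] that are dominated by the
    norm; domination makes such a relation single-valued. *)
Definition dominated_graph G : Prop :=
  (forall a x r y s, G (x, r) -> G (y, s) -> G (a *: x + y, a * r + s)) /\
  (forall x r, G (x, r) -> r <= `|x|).

Lemma dominated_graph0 G x r : dominated_graph G -> G (x, r) -> G (0, 0).
Proof.
move=> [Glin _] Gx; have := Glin (-1) _ _ _ _ Gx Gx.
by rewrite scaleN1r mulN1r !addNr.
Qed.

Lemma dominated_graphZ G a x r :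
  dominated_graph G -> G (x, r) -> G (a *: x, a * r).
Proof.
move=> DG Gx; have := DG.1 a _ _ _ _ Gx (dominated_graph0 DG Gx).
by rewrite !addr0.
Qed.

Lemma dominated_graph_fun G x r s :
  dominated_graph G -> G (x, r) -> G (x, s) -> r = s.
Proof.
move=> DG Gr Gs; apply: le_anti.
have sub r' s' : G (x, r') -> G (x, s') -> r' <= s'.
  move=> Gr' Gs'; have := DG.1 (-1) _ _ _ _ Gs' Gr'.
  by rewrite scaleN1r mulN1r addNr => /(DG.2); rewrite normr0; lra.
by rewrite !sub.
Qed.

(** The one-dimensional extension step: the value [c] at the new vector has to
    lie between the numbers [r - `|x - y|] and the numbers [`|x + y| - r]. *)
Lemma dominated_graph_extend G x0 r0 y : dominated_graph G -> G (x0, r0) ->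
  exists c, dominated_graph [set p | exists x r a,
    G (x, r) /\ p = (x + a *: y, r + a * c)].
Proof.
move=> DG Gx0; pose L := [set p.2 - `|p.1 - y| | p in G].
have Lub x r : G (x, r) -> ubound L (`|x + y| - r).
  move=> Gx _ [[x' r'] /= Gx' <-].
  have := DG.2 _ _ (DG.1 1 _ _ _ _ Gx Gx'); rewrite scale1r mul1r.
  have -> : x + x' = (x + y) + (x' - y) by rewrite addrACA subrr addr0.
  by move=> /le_trans/(_ (ler_normD _ _)); lra.
have L0 : L !=set0 by exists (r0 - `|x0 - y|), (x0, r0).
have above x r : G (x, r) -> r + sup L <= `|x + y|.
  by move=> Gx; rewrite -lerBrDl; apply: ge_sup => //; exact: Lub.
have below x r : G (x, r) -> r - sup L <= `|x - y|.
  move=> Gx; rewrite lerBlDr -lerBlDl; apply: ub_le_sup; last by exists (x, r).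
  by exists (`|x0 + y| - r0); exact: Lub.
exists (sup L); split=> [a z1 s1 z2 s2|].
  move=> [x1 [r1 [a1 [G1 [-> ->]]]]] [x2 [r2 [a2 [G2 [-> ->]]]]].
  exists (a *: x1 + x2), (a * r1 + r2), (a * a1 + a2); split; first exact: DG.1.
  by congr pair; [rewrite scalerDr scalerDl scalerA addrACA|lra].
move=> z s [x [r [a [Gx [-> ->]]]]].
have scaled b : 0 < b -> G (b^-1 *: x, b^-1 * r).
  by move=> _; exact: dominated_graphZ.
case: (ltgtP a 0) => [a0|a0|->]; last by rewrite mul0r scale0r !addr0 DG.2.
- have b0 : 0 < - a by rewrite oppr_gt0.
  have := below _ _ (scaled _ b0); rewrite -(ler_pM2l b0).
  rewrite -{3}(gtr0_norm b0) -normrZ mulrBr scalerBr scalerA !mulrA.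
  by rewrite !divff ?gt_eqF// mul1r scale1r mulNr scaleNr !opprK.
- have := above _ _ (scaled _ a0); rewrite -(ler_pM2l a0).
  rewrite -{3}(gtr0_norm a0) -normrZ mulrDr scalerDr scalerA !mulrA.
  by rewrite !divff ?gt_eqF// mul1r scale1r.
Qed.

(** A maximal dominated graph has full domain by [dominated_graph_extend].  The
    graphs are required to contain [(u, `|u|)] only when they are nonempty, so
    that the union of the empty chain qualifies. *)
Lemma hahn_banach_norming u :
  exists f : E -> R, [/\ forall a x y, f (a *: x + y) = a * f x + f y,
    forall x, `|f x| <= `|x| & f u = `|u|].
Proof.
pose P G := dominated_graph G /\ (G !=set0 -> G (u, `|u|)).
have [F FP Ftot|A [[DA Au] Amax]] := @Zorn_bigcup (E * R) P.
  split; last first.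
    by move=> [p [G FG Gp]]; exists G => //; apply: (FP G FG).2; exists p.
  split=> [a x r y s [G FG Gx] [H FH Hy]|x r [G FG Gx]]; last first.
    exact: (FP G FG).1.2 Gx.
  have [GH|HG] := Ftot _ _ FG FH.
    by exists H => //; apply: (FP H FH).1.1 => //; exact: GH.
  by exists G => //; apply: (FP G FG).1.1 => //; exact: HG.
have {}Au : A (u, `|u|).
  apply: Au; apply/set0P/eqP => A0.
  apply: (Amax [set p | exists a, p = (a *: u, a * `|u|)]).
    by rewrite A0; split=> // /(_ (1 *: u, 1 * `|u|)); apply; exists 1.
  split; last by exists 1; rewrite scale1r mul1r.
  split=> [a x r y s [b [-> ->]] [c [-> ->]]|x r [a [-> ->]]].
    by exists (a * b + c); rewrite scalerA -scalerDl mulrA -mulrDl.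
  by rewrite normrZ ler_wpM2r// ler_norm.
have Atotal y : exists r, A (y, r).
  apply: contrapT => yA.
  have [c] := dominated_graph_extend y DA Au; set B := [set _ | _] => DB.
  have AB : A `<=` B.
    by move=> [x r] Ax; exists x, r, 0; rewrite scale0r mul0r !addr0.
  apply: (Amax B); last by split=> // _; exact: AB.
  split=> // BA; apply: yA; exists c; apply: BA; exists 0, 0, 1.
  by rewrite scale1r mul1r !add0r; split=> //; exact: dominated_graph0 DA Au.
have /choice[f Af] := Atotal; exists f; split=> [a x y|x|].
- by apply: (dominated_graph_fun DA (Af _)); apply: DA.1.
- rewrite ler_norml DA.2// andbT lerNl -normrN; apply: DA.2.
  by have := dominated_graphZ (-1) DA (Af x); rewrite scaleN1r mulN1r.
- exact: (dominated_graph_fun DA (Af _)).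
Qed.

End HahnBanach.

(** * The real line as a Banach lattice *)

Section RealLattice.
Context {R : realType}.
Implicit Types x y z : R^o.

Let real_le (x y : R^o) : bool := (x : R) <= y.
Let real_join (x y : R^o) : R^o := Num.max (x : R) y.
Let real_meet (x y : R^o) : R^o := Num.min (x : R) y.

Fact real_le_refl : reflexive real_le. Proof. exact: lexx. Qed.
Fact real_le_anti : antisymmetric real_le. Proof. exact: le_anti. Qed.
Fact real_le_trans : transitive real_le. Proof. exact: le_trans. Qed.
Fact real_le_join x y z :
  real_le (real_join x y) z = real_le x z && real_le y z.
Proof. exact: ge_max. Qed.
Fact real_le_meet x y z :
  real_le z (real_meet x y) = real_le z x && real_le z y.
Proof. exact: le_min. Qed.
Fact real_le_addr z x y : real_le x y -> real_le (x + z) (y + z).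
Proof. by rewrite /real_le lerD2r. Qed.
Fact real_le_scale (a : R) x : 0 <= a -> real_le 0 x -> real_le 0 (a *: x).
Proof. exact: mulr_ge0. Qed.

HB.instance Definition _ := Lmodule_isVectorLattice.Build R R^o
  real_le_refl real_le_anti real_le_trans real_le_join real_le_meet
  real_le_addr real_le_scale.

Fact real_ler_norm x y : vabs x <=v vabs y -> `|x| <= `|y|.
Proof. by rewrite /vabs /vjoin /vle /= /real_join /real_le -!maxrN. Qed.

HB.instance Definition _ :=
  VectorLattice_isBanachLattice.Build R R^o real_ler_norm.

End RealLattice.

(** The functional calculus of the real line is evaluation, so that the
    inequality follows from [1 <= cc_M D g] and from [0 <= g] on the positive
    cone. *)
Lemma real_convex (R : realType) (D : convexity_condition R) : convex_for D R^o.
Proof.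
move=> m g Dg x x0 _.
have -> : func_calc x = (fun h : phfun R m => h (\row_k x k) : R^o).
  by apply: func_calcE => // k; rewrite /= mxE.
have xE : \row_k x k = \row_k `|x k|.
  by apply/rowP => k; rewrite !mxE [in RHS]ger0_norm//; exact: x0.
have g0 : 0 <= g (\row_k x k).
  rewrite -(phfun0 g); apply: (cc_monotone Dg) => k; rewrite !mxE lexx.
  exact: x0.
by rewrite ger0_norm// -xE ler_peMl// (cc_M_ge1 Dg).
Qed.

(** * Vector lattice expressions *)

Inductive lattice_term (K V : Type) : Type :=
| LVar of V
| LAdd of lattice_term K V & lattice_term K V
| LScale of K & lattice_term K V
| LJoin of lattice_term K V & lattice_term K V.

Arguments LVar {K V}.

Section Interp.
Context {K : numFieldType} {V : Type}.

Fixpoint interp (X : vectorLatticeType K) (T : V -> X)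
    (t : lattice_term K V) : X :=
  match t with
  | LVar u => T u
  | LAdd t1 t2 => interp T t1 + interp T t2
  | LScale a t1 => a *: interp T t1
  | LJoin t1 t2 => vjoin (interp T t1) (interp T t2)
  end.

Lemma lhom_interp (X Y : vectorLatticeType K) (f : X -> Y) (T : V -> X) t :
  lattice_hom f -> f (interp T t) = interp (f \o T) t.
Proof.
move=> fh; elim: t => //= [t1 <- t2 <-|a t <-|t1 <- t2 <-].
- exact: lhomD.
- exact: lhomZ.
- exact: lhom_join.
Qed.

End Interp.

(** * The completion of the expressions *)

(** Only contractions are used as indices, so that the values of an expression
    are uniformly bounded. *)
Record representation (R : realType) (E : completeNormedModType R)
    (D : convexity_condition R) := Representation {
  rep_lattice : banachLatticeType R ;
  rep_map :> {linear E -> rep_lattice} ;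
  rep_convex : convex_for D rep_lattice ;
  rep_contraction : forall u, `|rep_map u| <= `|u| }.

Section FreeBanachLattice.
Context {R : realType} (E : completeNormedModType R).
Context (D : convexity_condition R).
Local Notation rep := (representation E D).
Local Notation term := (lattice_term R E).
Implicit Types (i : rep) (t : term).

Lemma norming_representation (u : E) : exists i : rep, `|i u| = `|u|.
Proof.
have [f [flin fle fu]] := hahn_banach_norming u.
pose fL : {linear E -> R^o} :=
  HB.pack (f : E -> R^o) (GRing.isLinear.Build R E R^o *:%R f flin).
exists (@Representation _ E D R^o fL (@real_convex R D) fle).
by rewrite /= fu normr_id.
Qed.

Lemma interp_bounded t : exists2 C, 0 <= C & forall i, `|interp i t| <= C.
Proof.
elim: t => [u|t1 [C1 C10 tC1] t2 [C2 C20 tC2]|a t [C C0 tC]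
           |t1 [C1 C10 tC1] t2 [C2 C20 tC2]] /=.
- by exists `|u| => // i; exact: rep_contraction.
- exists (C1 + C2); first exact: addr_ge0.
  by move=> i; rewrite (le_trans (ler_normD _ _))// lerD.
- exists (`|a| * C); first exact: mulr_ge0.
  by move=> i; rewrite normrZ ler_wpM2l// tC.
- exists (C1 + C2); first exact: addr_ge0.
  move=> i; have := ler_norm_join (interp i t1) (interp i t2) 0 0.
  rewrite (proj2 (vjoin_idPr 0 0) (vle_refl 0)) !subr0 => /le_trans; apply.
  exact: lerD.
Qed.

Definition uniformly_cauchy (s : nat -> term) : Prop :=
  forall e, 0 < e -> exists N, forall p q, (N <= p)%N -> (N <= q)%N ->
  forall i, `|interp i (s p) - interp i (s q)| <= e.

(** Sequences of expressions, rather than families of values indexed by all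
    representations, keep the carrier in the universe of [E] although the
    representations range over all Banach lattices. *)
Record cauchy_terms := CauchyTerms {
  cauchy_terms_val :> nat -> term ;
  cauchy_termsP : uniformly_cauchy cauchy_terms_val }.

HB.instance Definition _ := gen_eqMixin cauchy_terms.
HB.instance Definition _ := gen_choiceMixin cauchy_terms.

Definition pre_eval i (s : cauchy_terms) : rep_lattice i :=
  limn (fun n => interp i (s n)).

Lemma pre_eval_cvg i (s : cauchy_terms) :
  interp i (s n) @[n --> \oo] --> pre_eval i s.
Proof.
apply: cauchy_cvg; apply: cauchy_exP => e e0.
have e20 : 0 < e / 2 by rewrite divr_gt0.
have [N sN] := cauchy_termsP s e20.
exists (interp i (s N)); rewrite -ball_normE.
suff : \forall n \near \oo, `|interp i (s N) - interp i (s n)| < e by [].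
near=> n; apply: le_lt_trans (sN N n _ _ i) _ => //.
  by near: n; exact: nbhs_infty_ge.
by rewrite ltr_pdivrMr// ltr_pMr// ltr1n.
Unshelve. all: by end_near. Qed.

Lemma pre_eval_approx (s : cauchy_terms) e : 0 < e ->
  exists N, forall n, (N <= n)%N ->
  forall i, `|pre_eval i s - interp i (s n)| <= e.
Proof.
move=> e0; have [N sN] := cauchy_termsP s e0; exists N => n Nn i.
have : `|interp i (s p) - interp i (s n)| @[p --> \oo]
    --> `|pre_eval i s - interp i (s n)|.
  by apply: cvg_norm; apply: cvgB; [exact: pre_eval_cvg|exact: cvg_cst].
move=> /cvgr_to_le; apply; near=> p; apply: sN => //.
by near: p; exact: nbhs_infty_ge.
Unshelve. all: by end_near. Qed.

Definition pre_equiv (s s' : cauchy_terms) : bool :=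
  `[< forall i, pre_eval i s = pre_eval i s' >].

Lemma pre_equiv_refl : reflexive pre_equiv.
Proof. by move=> s; apply/asboolP. Qed.

Lemma pre_equiv_sym : symmetric pre_equiv.
Proof. by move=> s s'; apply/asboolP/asboolP => h i; rewrite h. Qed.

Lemma pre_equiv_trans : transitive pre_equiv.
Proof.
by move=> s s' s'' /asboolP h /asboolP h'; apply/asboolP => i; rewrite h h'.
Qed.

Canonical pre_equiv_rel :=
  EquivRel pre_equiv pre_equiv_refl pre_equiv_sym pre_equiv_trans.

Definition FBL : Type := {eq_quot pre_equiv}%qT.
HB.instance Definition _ := Choice.on FBL.

Definition FBL_eval i (x : FBL) : rep_lattice i := pre_eval i (repr x).

Lemma eval_inj (x y : FBL) : (forall i, FBL_eval i x = FBL_eval i y) -> x = y.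
Proof.
move=> xy; rewrite -[x]reprK -[y]reprK; apply/eqmodP.
exact/asboolP.
Qed.

(** All elements of [FBL] below, in particular the results of its operations,
    are obtained as limits in this sense. *)
Lemma FBL_limit (s : nat -> term) : uniformly_cauchy s ->
  exists x : FBL, forall i, interp i (s n) @[n --> \oo] --> FBL_eval i x.
Proof.
move=> sc; pose c := CauchyTerms sc.
exists (\pi_FBL c)%qT => i.
suff -> : FBL_eval i (\pi_FBL c)%qT = pre_eval i c by exact: pre_eval_cvg.
have /eqmodP/asboolP := reprK (\pi_FBL c)%qT.
exact.
Qed.

End FreeBanachLattice.

(** * The Banach lattice structure *)

Lemma dist_trans {R : numDomainType} {V : normedZmodType R} (x y z : V)
    (a b : R) :
  `|x - y| <= a -> `|y - z| <= b -> `|x - z| <= a + b.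
Proof. by move=> xy yz; apply: le_trans (ler_distD y x z) (lerD xy yz). Qed.

Lemma dist_sym {R : numDomainType} {V : normedZmodType R} (x y : V) (a : R) :
  `|x - y| <= a -> `|y - x| <= a.
Proof. by rewrite distrC. Qed.

Section FreeBanachLatticeStructure.
Context {R : realType} (E : completeNormedModType R).
Context (D : convexity_condition R).
Local Notation rep := (representation E D).
Local Notation term := (lattice_term R E).
Local Notation FBL := (FBL E D).
Implicit Types (i : rep) (t : term) (x y z : FBL).

(** Each operation on expressions is Lipschitz in every representation with a
    constant that does not depend on the representation, and hence acts on
    uniformly Cauchy sequences. *)
Lemma uniformly_cauchy_lipschitz (C : R) (s s' r : nat -> term) : 0 <= C ->
  (forall p q i, `|interp i (r p) - interp i (r q)| <=
    C * (`|interp i (s p) - interp i (s q)| +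
         `|interp i (s' p) - interp i (s' q)|)) ->
  uniformly_cauchy D s -> uniformly_cauchy D s' -> uniformly_cauchy D r.
Proof.
move=> C0 rC sc s'c e e0.
pose d := e / (2 * (C + 1)).
have d0 : 0 < d by rewrite divr_gt0// mulr_gt0// ltr_wpDl.
have dE : d * (2 * (C + 1)) = e.
  by rewrite divfK// mulf_neq0// gt_eqF// ltr_wpDl.
have [N sN] := sc _ d0; have [N' s'N'] := s'c _ d0.
exists (maxn N N') => p q; rewrite !geq_max => /andP[Np N'p] /andP[Nq N'q] i.
apply: le_trans (rC p q i) _.
have -> : e = (C + 1) * (d + d) by rewrite -dE; lra.
by rewrite ler_pM// ?addr_ge0// ?lerDl// lerD ?sN ?s'N'.
Qed.

Lemma FBL_add_exists x y :
  exists z, forall i, FBL_eval i z = FBL_eval i x + FBL_eval i y.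
Proof.
have [|z zP] := @FBL_limit _ E D (fun n => LAdd (repr x n) (repr y n)).
  apply: (@uniformly_cauchy_lipschitz 1 (repr x) (repr y)) => // [p q i /=||].
  - by rewrite mul1r opprD addrACA ler_normD.
  - exact: cauchy_termsP.
  - exact: cauchy_termsP.
exists z => i; apply: (@cvg_unique _ (@norm_hausdorff _ _) _ _ _ _ (zP i)).
by apply: cvgD; exact: pre_eval_cvg.
Qed.

Lemma FBL_scale_exists a x :
  exists z, forall i, FBL_eval i z = a *: FBL_eval i x.
Proof.
have [|z zP] := @FBL_limit _ E D (fun n => LScale a (repr x n)).
  apply: (@uniformly_cauchy_lipschitz `|a| (repr x) (repr x)) =>
    // [p q i /=||].
  - by rewrite -scalerBr normrZ ler_wpM2l// lerDl.
  - exact: cauchy_termsP.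
  - exact: cauchy_termsP.
exists z => i; apply: (@cvg_unique _ (@norm_hausdorff _ _) _ _ _ _ (zP i)).
by apply: cvgZr; exact: pre_eval_cvg.
Qed.

Lemma FBL_join_exists x y :
  exists z, forall i, FBL_eval i z = vjoin (FBL_eval i x) (FBL_eval i y).
Proof.
have [|z zP] := @FBL_limit _ E D (fun n => LJoin (repr x n) (repr y n)).
  apply: (@uniformly_cauchy_lipschitz 1 (repr x) (repr y)) => // [p q i /=||].
  - by rewrite mul1r ler_norm_join.
  - exact: cauchy_termsP.
  - exact: cauchy_termsP.
exists z => i; apply: (@cvg_unique _ (@norm_hausdorff _ _) _ _ _ _ (zP i)).
by apply: cvg_vjoin; exact: pre_eval_cvg.
Qed.

Lemma FBL_term_exists t : exists z : FBL, forall i, FBL_eval i z = interp i t.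
Proof.
have [|z zP] := @FBL_limit _ E D (fun=> t).
  by move=> e e0; exists 0%N => p q _ _ i; rewrite subrr normr0 ltW.
exists z => i; apply: (@cvg_unique _ (@norm_hausdorff _ _) _ _ _ _ (zP i)).
exact: cvg_cst.
Qed.

Definition FBL_add x y : FBL := sval (cid (FBL_add_exists x y)).
Definition FBL_scale a x : FBL := sval (cid (FBL_scale_exists a x)).
Definition FBL_join x y : FBL := sval (cid (FBL_join_exists x y)).
Definition FBL_term t : FBL := sval (cid (FBL_term_exists t)).
Definition FBL_opp x : FBL := FBL_scale (-1) x.
Definition FBL_meet x y : FBL := FBL_opp (FBL_join (FBL_opp x) (FBL_opp y)).

Lemma eval_add i x y : FBL_eval i (FBL_add x y) = FBL_eval i x + FBL_eval i y.
Proof. exact: (svalP (cid (FBL_add_exists x y))). Qed.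
Lemma eval_scale i a x : FBL_eval i (FBL_scale a x) = a *: FBL_eval i x.
Proof. exact: (svalP (cid (FBL_scale_exists a x))). Qed.
Lemma eval_join i x y :
  FBL_eval i (FBL_join x y) = vjoin (FBL_eval i x) (FBL_eval i y).
Proof. exact: (svalP (cid (FBL_join_exists x y))). Qed.
Lemma eval_term i t : FBL_eval i (FBL_term t) = interp i t.
Proof. exact: (svalP (cid (FBL_term_exists t))). Qed.
Lemma eval_opp i x : FBL_eval i (FBL_opp x) = - FBL_eval i x.
Proof. by rewrite eval_scale scaleN1r. Qed.
Lemma eval_meet i x y :
  FBL_eval i (FBL_meet x y) = vmeet (FBL_eval i x) (FBL_eval i y).
Proof. by rewrite eval_opp eval_join !eval_opp -vmeet_opp_join. Qed.

Fact FBL_addA : associative FBL_add.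
Proof. by move=> x y z; apply: eval_inj => i; rewrite !eval_add addrA. Qed.
Fact FBL_addC : commutative FBL_add.
Proof. by move=> x y; apply: eval_inj => i; rewrite !eval_add addrC. Qed.
Fact FBL_add0 : left_id (FBL_term (LVar 0)) FBL_add.
Proof.
by move=> x; apply: eval_inj => i; rewrite eval_add eval_term /= linear0 add0r.
Qed.
Fact FBL_addN : left_inverse (FBL_term (LVar 0)) FBL_opp FBL_add.
Proof.
move=> x; apply: eval_inj => i.
by rewrite eval_add eval_opp eval_term /= linear0 addNr.
Qed.

HB.instance Definition _ :=
  GRing.isZmodule.Build FBL FBL_addA FBL_addC FBL_add0 FBL_addN.

Fact FBL_scaleA (a b : R) x : FBL_scale a (FBL_scale b x) = FBL_scale (a * b) x.
Proof. by apply: eval_inj => i; rewrite !eval_scale scalerA. Qed.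
Fact FBL_scale1 : left_id 1 FBL_scale.
Proof. by move=> x; apply: eval_inj => i; rewrite eval_scale scale1r. Qed.
Fact FBL_scaleDr : right_distributive FBL_scale +%R.
Proof.
move=> a x y; apply: eval_inj => i.
by rewrite eval_scale !eval_add !eval_scale scalerDr.
Qed.
Fact FBL_scaleDl x : {morph FBL_scale^~ x : a b / a + b}.
Proof.
by move=> a b; apply: eval_inj => i; rewrite eval_add !eval_scale scalerDl.
Qed.

HB.instance Definition _ := GRing.Zmodule_isLmodule.Build R FBL
  FBL_scaleA FBL_scale1 FBL_scaleDr FBL_scaleDl.

Lemma eval_linear i : linear (@FBL_eval _ E D i).
Proof. by move=> a x y; rewrite eval_add eval_scale. Qed.

Lemma FBL_eval0 i : FBL_eval i (0 : FBL) = 0.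
Proof. by rewrite eval_term /= linear0. Qed.

Definition FBL_le x y : bool := `[< forall i, FBL_eval i x <=v FBL_eval i y >].

Fact FBL_le_refl : reflexive FBL_le.
Proof. by move=> x; apply/asboolP => i; exact: vle_refl. Qed.
Fact FBL_le_anti : antisymmetric FBL_le.
Proof.
move=> x y /andP[/asboolP xy /asboolP yx].
by apply: eval_inj => i; exact: vle_eq.
Qed.
Fact FBL_le_trans : transitive FBL_le.
Proof.
move=> y x z /asboolP xy /asboolP yz; apply/asboolP => i.
exact: vle_trans (xy i) (yz i).
Qed.
Fact FBL_le_join x y z : FBL_le (FBL_join x y) z = FBL_le x z && FBL_le y z.
Proof.
apply/asboolP/andP => [xyz|[/asboolP xz /asboolP yz] i].
  by split; apply/asboolP => i; have := xyz i;
    rewrite eval_join vle_join => /andP[].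
by rewrite eval_join vle_join xz yz.
Qed.
Fact FBL_le_meet x y z : FBL_le z (FBL_meet x y) = FBL_le z x && FBL_le z y.
Proof.
apply/asboolP/andP => [zxy|[/asboolP zx /asboolP zy] i].
  by split; apply/asboolP => i; have := zxy i;
    rewrite eval_meet vle_meet => /andP[].
by rewrite eval_meet vle_meet zx zy.
Qed.
Fact FBL_le_addr z x y : FBL_le x y -> FBL_le (x + z) (y + z).
Proof.
by move=> /asboolP xy; apply/asboolP => i; rewrite !eval_add; exact: vle_addr.
Qed.
Fact FBL_le_scale (a : R) x : 0 <= a -> FBL_le 0 x -> FBL_le 0 (a *: x).
Proof.
move=> a0 /asboolP x0; apply/asboolP => i; rewrite eval_scale FBL_eval0.
by apply: vle_scale => //; rewrite -(FBL_eval0 i).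
Qed.

HB.instance Definition _ := Lmodule_isVectorLattice.Build R FBL
  FBL_le_refl FBL_le_anti FBL_le_trans FBL_le_join FBL_le_meet FBL_le_addr
  FBL_le_scale.

Lemma eval_lattice_hom i : lattice_hom (@FBL_eval _ E D i).
Proof.
split; first exact: eval_linear.
  by move=> x y; exact: eval_join.
by move=> x y; exact: eval_meet.
Qed.

Definition FBL_norm x : R := sup [set r | exists i, r = `|FBL_eval i x|].

Lemma eval_approx x e : 0 < e ->
  exists t, forall i, `|FBL_eval i x - interp i t| <= e.
Proof.
move=> e0; have [N xN] := pre_eval_approx (repr x) e0.
by exists (repr x N); exact: xN.
Qed.

Lemma ler_eval_norm i x : `|FBL_eval i x| <= FBL_norm x.
Proof.
apply: ub_le_sup; last by exists i.
have [t xt] := eval_approx x ltr01; have [C _ tC] := interp_bounded D t.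
exists (1 + C) => _ [j ->]; rewrite -[FBL_eval j x](subrK (interp j t)).
by rewrite (le_trans (ler_normD _ _))// lerD.
Qed.

Lemma FBL_norm_le x c : (forall i, `|FBL_eval i x| <= c) -> FBL_norm x <= c.
Proof.
move=> xc; apply: ge_sup; last by move=> _ [i ->].
by have [i _] := norming_representation D (0 : E); exists `|FBL_eval i x|, i.
Qed.

Fact FBL_ler_normD x y : FBL_norm (x + y) <= FBL_norm x + FBL_norm y.
Proof.
apply: FBL_norm_le => i; rewrite eval_add (le_trans (ler_normD _ _))//.
by rewrite lerD// ler_eval_norm.
Qed.

Fact FBL_normrZ (a : R) x : FBL_norm (a *: x) = `|a| * FBL_norm x.
Proof.
have le b y : FBL_norm (b *: y) <= `|b| * FBL_norm y.
  apply: FBL_norm_le => i.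
  by rewrite eval_scale normrZ ler_wpM2l// ler_eval_norm.
apply/eqP; rewrite eq_le le /=; have [->|a0] := eqVneq a 0.
  rewrite normr0 mul0r; have [i _] := norming_representation D (0 : E).
  exact: le_trans (ler_eval_norm i _).
rewrite -{1}[x](scalerK a0) -ler_pdivlMl ?normr_gt0//.
by rewrite -normfV; exact: le.
Qed.

Fact FBL_normr0_eq0 x : FBL_norm x = 0 -> x = 0.
Proof.
move=> x0; apply: eval_inj => i; rewrite FBL_eval0.
by apply/eqP; rewrite -normr_le0 -x0 ler_eval_norm.
Qed.

HB.instance Definition _ := Lmodule_isNormed.Build R FBL
  FBL_ler_normD FBL_normrZ FBL_normr0_eq0.

Lemma FBL_term_dense x e : 0 < e -> exists t, `|x - FBL_term t| <= e.
Proof.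
move=> e0; have [t xt] := eval_approx x e0; exists t.
by apply: FBL_norm_le => i; rewrite eval_add eval_opp eval_term.
Qed.

(** A Cauchy filter is followed by a sequence of elements, and the latter by a
    sequence of expressions, by density; this sequence is uniformly Cauchy and
    so defines the limit. *)
Fact FBL_complete (F : set_system FBL) : ProperFilter F -> cauchy F -> cvg F.
Proof.
move=> FF /cauchyP Fc.
pose d n : R := n.+1%:R^-1.
have d0 n : 0 < d n by rewrite invr_gt0.
have /choice[a Fa] n : exists x, F (ball x (d n)) by exact: Fc.
have /choice[t at_] n : exists t, `|a n - FBL_term t| <= d n.
  exact: FBL_term_dense.
have tt p q : `|FBL_term (t p) - FBL_term (t q)| <= (d p + d p) + (d q + d q).
  have [y []] := filter_ex (filterI (Fa p) (Fa q)).
  rewrite -!ball_normE /= => /ltW apy /ltW aqy.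
  by apply: (dist_trans (y := y)); last apply: dist_sym;
    apply: dist_trans (dist_sym (at_ _)) _.
have dsmall e : 0 < e -> exists N, forall n, (N <= n)%N -> d n <= e.
  have : d n @[n --> \oo] --> (0 : R) by exact: cvg_harmonic.
  move=> /cvgrPdist_le dcvg e0; have [N _ dN] := dcvg e e0.
  exists N => n /dN; rewrite /= sub0r normrN gtr0_norm//.
have interpB i t1 t2 :
    `|interp i t1 - interp i t2| <= `|FBL_term t1 - FBL_term t2|.
  apply: le_trans (ler_eval_norm i _).
  by rewrite eval_add eval_opp !eval_term.
have [e e0|x tx] := @FBL_limit _ E D t.
  have e40 : 0 < e / 4 by rewrite divr_gt0.
  have [N dN] := dsmall _ e40; exists N => p q Np Nq i.
  apply: le_trans (interpB _ _ _) (le_trans (tt p q) _).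
  by have := dN _ Np; have := dN _ Nq; clear; lra.
apply/cvg_ex; exists x; apply/cvgrPdist_le => e e0.
have e60 : 0 < e / 6 by rewrite divr_gt0.
have [N dN] := dsmall _ e60.
have xt : `|x - FBL_term (t N)| <= (e / 6 + e / 6) + (d N + d N).
  apply: FBL_norm_le => i; rewrite eval_add eval_opp eval_term.
  have : `|interp i (t p) - interp i (t N)| @[p --> \oo]
      --> `|FBL_eval i x - interp i (t N)|.
    by apply: cvg_norm; apply: cvgB; [exact: tx|exact: cvg_cst].
  move=> /cvgr_to_le; apply; near=> p.
  apply: le_trans (interpB _ _ _) (le_trans (tt p N) _).
  have : d p <= e / 6 by apply: dN; near: p; exact: nbhs_infty_ge.
  by clear; lra.
apply: filterS (Fa N) => y; rewrite -ball_normE /= => /ltW Ny.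
have := dist_trans xt (dist_trans (dist_sym (at_ N)) Ny).
move=> /le_trans; apply; have := dN N (leqnn N); clear; lra.
Unshelve. all: by end_near. Qed.

HB.instance Definition _ := Uniform_isComplete.Build FBL FBL_complete.

Fact FBL_ler_norm x y : vabs x <=v vabs y -> `|x| <= `|y|.
Proof.
move=> /asboolP xy; apply: FBL_norm_le => i.
apply: le_trans (ler_eval_norm i y).
by apply: bl_ler_norm; rewrite -!(lhom_abs (eval_lattice_hom i)); exact: xy.
Qed.

HB.instance Definition _ :=
  VectorLattice_isBanachLattice.Build R FBL FBL_ler_norm.

End FreeBanachLatticeStructure.

(** * The universal property *)

Section UniversalProperty.
Context {R : realType} (E : completeNormedModType R).
Context (D : convexity_condition R).
Local Notation FBL := (FBL E D).
Implicit Types (x y : FBL).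

(** Evaluations preserve positivity and disjointness, so that the inequality
    holds for the image of [x] in each representation; monotonicity of [g]
    bounds the right-hand side by the one for [x]. *)
Theorem FBL_convex : convex_for D FBL.
Proof.
move=> m g Dg x x0 xdisj.
have xg0 : 0 <= cc_M D g * g (\row_k `|x k|).
  rewrite mulr_ge0 ?(le_trans ler01 (cc_M_ge1 Dg))//.
  by rewrite -(phfun0 g); apply: (cc_monotone Dg) => k; rewrite !mxE lexx /=.
have [->|x_calc] := pselect (func_calc x g = 0); first by rewrite normr0.
apply: FBL_norm_le => i; have ih := eval_lattice_hom (E := E) (D := D) i.
have [//|->] := lhom_func_calc x g ih.
have convex_i : `|func_calc (FBL_eval i \o x) g| <=
    cc_M D g * g (\row_k `|FBL_eval i (x k)|).
  apply: (@rep_convex _ _ _ i) => // [k|theta0 j k jk /=].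
    by have := lhom_le ih (x0 k); rewrite (lhom0 ih).
  have := congr1 (FBL_eval i) (xdisj theta0 j k jk).
  by rewrite (lhom_meet ih) !(lhom_abs ih) (lhom0 ih).
apply: le_trans convex_i _; rewrite ler_wpM2l ?(le_trans ler01 (cc_M_ge1 Dg))//.
apply: (cc_monotone Dg) => k; rewrite !mxE normr_ge0 /=.
exact: ler_eval_norm.
Qed.

Definition FBL_var (u : E) : FBL := FBL_term D (LVar u).

Fact FBL_var_linear : linear FBL_var.
Proof.
move=> a u v; apply: eval_inj => i.
by rewrite eval_linear !eval_term /= linearP.
Qed.

HB.instance Definition _ :=
  GRing.isLinear.Build R E FBL *:%R FBL_var FBL_var_linear.

Lemma FBL_var_isometry u : `|FBL_var u| = `|u|.
Proof.
apply/eqP; rewrite eq_le; apply/andP; split.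
  by apply: FBL_norm_le => i; rewrite eval_term; exact: rep_contraction.
have [i <-] := norming_representation D u.
by have := ler_eval_norm i (FBL_var u); rewrite eval_term.
Qed.

Lemma FBL_term_interp t : FBL_term D t = interp FBL_var t.
Proof.
apply: eval_inj => i; rewrite eval_term (lhom_interp _ _ (eval_lattice_hom i)).
by congr interp; apply/funext => u; rewrite /= eval_term.
Qed.

(** Both homomorphisms have the same value at every expression. *)
Lemma FBL_hom_unique (X : banachLatticeType R) (S S' : FBL -> X) :
  lattice_hom S -> lattice_hom S' -> S \o FBL_var = S' \o FBL_var -> S = S'.
Proof.
move=> Sh S'h SS'.
apply: (@lattice_hom_eq_dense _ _ _ _ _ (range (@FBL_term _ E D))) => //.
  move=> x e e0; have [t xt] := FBL_term_dense x e0.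
  by exists (FBL_term D t) => //; exists t.
by move=> _ [t _ <-]; rewrite FBL_term_interp !lhom_interp// SS'.
Qed.

(** The operator [c^-1 *: T] is one of the representations. *)
Lemma FBL_extension (X : banachLatticeType R) (T : {linear E -> X}) c :
  convex_for D X -> 0 < c -> (forall u, `|T u| <= c * `|u|) ->
  exists S : FBL -> X,
    [/\ lattice_hom S, S \o FBL_var = T & forall x, `|S x| <= c * `|x|].
Proof.
move=> XD c0 Tc.
have Tlin : linear (fun u => c^-1 *: T u).
  by move=> a u v; rewrite linearP scalerDr !scalerA mulrC.
pose T1 : {linear E -> X} :=
  HB.pack (fun u => c^-1 *: T u) (GRing.isLinear.Build R E X *:%R _ Tlin).
have T1c u : `|T1 u| <= `|u|.
  by rewrite /= normrZ gtr0_norm ?invr_gt0// ler_pdivrMl.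
pose i := @Representation _ E D X T1 XD T1c.
exists (fun x => c *: (FBL_eval i x : X)); split.
- apply: lattice_hom_linear => [a x y|x y].
    by rewrite eval_linear scalerDr !scalerA mulrC.
  by rewrite eval_join vjoin_scale// ltW.
- by apply/funext => u /=; rewrite eval_term /= scalerA divff ?gt_eqF// scale1r.
- by move=> x; rewrite normrZ gtr0_norm// ler_pM2l//; exact: (ler_eval_norm i).
Qed.

Lemma opnorm_ge (U V : normedModType R) (f : U -> V) u :
  `|u| <= 1 -> (`|f u|%:E <= opnorm f)%E.
Proof. by move=> u1; apply: ereal_sup_ubound; exists u. Qed.

Lemma opnorm_bound (U V : normedModType R) (f : {linear U -> V}) c :
  opnorm f = c%:E -> forall u, `|f u| <= c * `|u|.
Proof.
move=> fc u; have [->|u0] := eqVneq u 0; first by rewrite linear0 !normr0 mulr0.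
have := opnorm_ge f (u := `|u|^-1 *: u); rewrite fc lee_fin linearZ !normrZ.
rewrite normfV normr_id mulVf ?normr_eq0// => /(_ (lexx _)).
by rewrite ler_pdivrMl ?normr_gt0// mulrC.
Qed.

(** By uniqueness [S] is the extension of [FBL_extension] for every bound
    [c + e] of [T], where the positive [e] keeps the factor nonzero when
    [T = 0]. *)
Lemma FBL_extension_opnorm (X : banachLatticeType R) (T : {linear E -> X})
    (S : FBL -> X) :
  convex_for D X -> lattice_hom S -> S \o FBL_var = T -> opnorm S = opnorm T.
Proof.
move=> XD Sh ST; apply/eqP; rewrite eq_le; apply/andP; split; last first.
  apply: ge_ereal_sup => _ [u u1 <-].
  by rewrite -ST; apply: opnorm_ge; rewrite FBL_var_isometry.
apply: ge_ereal_sup => _ [x x1 <-].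
case Tc : (opnorm T) => [c||]; [|exact: leey|]; last first.
  have := opnorm_ge T (u := 0); rewrite Tc normr0 => /(_ ler01).
  by rewrite linear0 normr0.
have c0 : 0 <= c.
  have := opnorm_ge T (u := 0); rewrite Tc normr0 => /(_ ler01).
  by rewrite linear0 normr0 lee_fin.
rewrite lee_fin; apply/ler_addgt0Pr => e e0.
have ce0 : 0 < c + e by rewrite ltr_wpDl.
have [u|S' [S'h S'T S'c]] := FBL_extension XD ce0 (T := T).
  by apply: le_trans (opnorm_bound Tc u) _; rewrite ler_wpM2r// lerDl ltW.
rewrite (FBL_hom_unique Sh S'h); last by rewrite ST.
by apply: le_trans (S'c x) _; rewrite ler_piMr// ltW.
Qed.

End UniversalProperty.

Theorem theorem3p3 (R : realType) (E : completeNormedModType R)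
    (D : convexity_condition R) :
  exists (FBL : banachLatticeType R) (phi : {linear E -> FBL}),
    [/\ convex_for D FBL,
        (forall u : E, `|phi u| = `|u|)
      & forall (X : banachLatticeType R) (T : {linear E -> X}),
          convex_for D X -> continuous T ->
          exists2 That : FBL -> X,
            unique (fun S : FBL -> X => lattice_hom S /\ S \o phi = T) That
            & opnorm That = opnorm T].
Proof.
exists (FBL E D : banachLatticeType R).
exists (@FBL_var R E D : {linear E -> FBL E D}).
split=> [||X T XD Tcont]; [exact: FBL_convex|exact: FBL_var_isometry|].
have [c c0 Tc] : exists2 c, 0 < c & forall u, `|T u| <= c * `|u|.
  exact/pinfty_ex_gt0/linear_boundedP/continuous_linear_bounded/Tcont.
have [S [Sh ST _]] := FBL_extension XD c0 Tc.
exists S; last exact: FBL_extension_opnorm.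
by split=> // S' [S'h S'T]; apply: FBL_hom_unique => //; rewrite ST -S'T.
Qed.
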